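(* For every integer $\Delta \geq 0$ and every integer $k \geq 2$: (1) $h(\Delta,k) \leq R(k,k) - 1$. (2) $h(0,k) = k-1$. (3) $h(1,k) = \lfloor \frac{k}{2} \rfloor + 2 \lfloor \frac{k-1}{2} \rfloor$. (4) For odd $k \geq 3$, $h(2,k) = 2k-2$, and for even $k \geq 2$, $h(2,k) = 2k-3$. (5) $h(\Delta,k) \leq g(\Delta,k) + k - 1$.
   Context: All graphs are finite and simple; $|G|$ is the number of vertices of $G$ and $\Delta(G)$ its maximum degree. $R(k,k)$ is the diagonal Ramsey number (the least $N$ such that every graph on at least $N$ vertices contains a clique or an independent set of size $k$). For an integer $k \geq 2$, a graph $G$ is $k$-feasible if it contains an induced subgraph $H$ (possibly $H = G$) such that at least $k$ vertices of $H$ have degree $\Delta(H)$ in $H$. Define $h(\Delta,k) = \max\{ |G| : \Delta(G) \leq \Delta \text{ and } G \text{ is not } k\text{-feasible}\}$. For a graph $G$ and an integer $k \geq 2$, $f_k(G)$ denotes the minimum number of vertices that must be deleted from $G$ to obtain an induced subgraph $H$ in which at least $k$ vertices have degree $\Delta(H)$, or otherwise $|H| < k$. Define $g(\Delta,k) = \max\{ f_k(G) : \Delta(G) \leq \Delta\}$, the maximum being over all graphs $G$ with maximum degree at most $\Delta$. *)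

(* Defs.v *)
From mathcomp Require Import all_boot.
From mathcomp Require Import boolp.

Set Implicit Arguments.
Unset Strict Implicit.
Unset Printing Implicit Defensive.

Record sgraph := SGraph {
  vertex :> finType;
  adj : rel vertex;
  adj_sym : symmetric adj;
  adj_irrefl : irreflexive adj }.

Section Graphs.
Implicit Type G : sgraph.

Definition degree G (v : G) : nat := #|[set u : G | adj v u]|.

Definition max_degree G : nat := \max_(v : G) degree v.

Definition max_degree_vertices G : {set G} :=
  [set v : G | degree v == max_degree G].

Definition induced_adj G (S : {set G}) : rel {x : G | x \in S} :=
  fun u v => adj (val u) (val v).

Lemma induced_adj_sym G (S : {set G}) : symmetric (@induced_adj G S).
Proof. by move=> u v; apply: adj_sym. Qed.

Lemma induced_adj_irrefl G (S : {set G}) : irreflexive (@induced_adj G S).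
Proof. by move=> u; apply: adj_irrefl. Qed.

Definition induced G (S : {set G}) : sgraph :=
  SGraph (@induced_adj_sym G S) (@induced_adj_irrefl G S).

Definition clique G (S : {set G}) : bool :=
  [forall u in S, forall v in S, (u != v) ==> adj u v].

Definition independent G (S : {set G}) : bool :=
  [forall u in S, forall v in S, ~~ adj u v].

Definition k_feasible (k : nat) G : bool :=
  [exists S : {set G}, k <= #|max_degree_vertices (induced S)|].

Definition good_deletion (k : nat) G (X : {set G}) : bool :=
  (k <= #|max_degree_vertices (induced (~: X))|) || (#|induced (~: X)| < k).

(* The arg min is over a nonempty family, see [good_deletionT]. *)
Definition fk (k : nat) G : nat :=
  #|[arg min_(X < [set: G] | good_deletion k X) #|X| ]|.

Lemma card_induced G (S : {set G}) : #|induced S| = #|S|.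
Proof. by rewrite card_sig; apply: eq_card. Qed.

Lemma good_deletionT k G : good_deletion k [set: G].
Proof.
by rewrite /good_deletion card_induced setCT cards0; case: k => [|k] //; rewrite orbT.
Qed.

Lemma degree_induced G (S : {set G}) (v : induced S) :
  degree v = #|[set u in S | adj (val v) u]|.
Proof.
rewrite /degree -(card_imset _ val_inj); apply: eq_card => u.
apply/imsetP/idP => [[w vw ->]|]; last first.
  by rewrite inE => /andP[uS vu]; exists (Sub u uS) => //; rewrite inE.
by move: vw; rewrite !inE (valP w).
Qed.

Lemma small_deletion k G d (S : {set G}) : max_degree (induced S) <= d ->
  exists T : {set G}, [/\ T \subset S, #|S :\: T| <= k * d &
    (k <= #|max_degree_vertices (induced T)|) || (#|T| < k)].
Proof.
elim: d S => [|d IH] S hS.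
  exists S; split; rewrite ?setDv ?cards0 //; case: (ltnP #|S| k) => lek.
    by rewrite orbT.
  rewrite orbF; suff -> : #|max_degree_vertices (induced S)| = #|S| by [].
  rewrite -(card_induced S) -cardsT.
  suff -> : max_degree_vertices (induced S) = setT by [].
  apply/setP => v; rewrite !inE.
  move: hS; rewrite leqn0 => /eqP hS; rewrite hS -leqn0 -hS.
  exact: leq_bigmax.
have [kM|kM] := leqP k #|max_degree_vertices (induced S)|.
  by exists S; split; rewrite ?setDv ?cards0 // kM.
pose M : {set G} := [set val v | v in max_degree_vertices (induced S)].
have [|T [TS cT goodT]] := IH (S :\: M).
  apply/bigmax_leqP => -[v hv] _; rewrite degree_induced /=.
  have /setDP[vS vM] := hv.
  rewrite -ltnS; apply: leq_trans hS.
  pose w : induced S := Sub v vS.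
  have : degree w < max_degree (induced S).
    rewrite ltn_neqAle leq_bigmax andbT; apply: contra vM => dw.
    by apply/imsetP; exists w => //; rewrite inE.
  apply: leq_ltn_trans; rewrite degree_induced; apply: subset_leq_card.
  by apply/subsetP => u; rewrite !inE => /andP[/andP[_ ->]].
exists T; split => //; first by apply: subset_trans TS (subsetDl _ _).
have cM : #|M| <= k by apply: leq_trans (leq_imset_card _ _) _; apply: ltnW.
have sub : S :\: T \subset M :|: ((S :\: M) :\: T).
  by apply/subsetP => u; rewrite !inE; case: (u \in M); case: (u \in T); case: (u \in S).
apply: leq_trans (subset_leq_card sub) _.
by rewrite mulnS; apply: leq_trans (leq_card_setU _ _) _; apply: leq_add.
Qed.

Lemma fk_ub k G D : max_degree G <= D -> fk k G <= k * D.
Proof.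
move=> hD.
have hT : max_degree (induced [set: G]) <= D.
  apply/bigmax_leqP => v _; apply: leq_trans hD.
  apply: leq_trans (@leq_bigmax _ (@degree G) (val v)).
  rewrite degree_induced; apply: subset_leq_card.
  by apply/subsetP => u; rewrite !inE.
have [T [_ cT gT]] := small_deletion k hT.
rewrite /fk; case: arg_minnP => [|X _ minX]; first exact: good_deletionT.
apply: leq_trans (minX (~: T) _) _; last by rewrite -setTD.
by rewrite /good_deletion setCK card_induced.
Qed.

Lemma nonfeasible_ub k G D : max_degree G <= D -> ~~ k_feasible k G ->
  #|G| <= k * D + k.
Proof.
move=> /(fk_ub k) hf nf; move: hf.
rewrite /fk; case: arg_minnP => [|X gX _ cX]; first exact: good_deletionT.
rewrite -(cardsC X); apply: leq_add => //.
case/orP: gX => [kX|]; last by rewrite card_induced => /ltnW.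
by case/existsP: nf; exists (~: X).
Qed.

Lemma ramsey_set a b G (S : {set G}) : 2 ^ (a + b) <= #|S| ->
  exists X : {set G}, X \subset S /\
    ((#|X| == a) && clique X || (#|X| == b) && independent X).
Proof.
elim: a b S => [|a IHa] b.
  move=> S _; exists set0; split; first exact: sub0set.
  rewrite cards0 eqxx /=; apply/orP; left.
  by apply/forall_inP => u; rewrite inE.
elim: b => [|b IHb] S hS.
  exists set0; split; first exact: sub0set.
  rewrite cards0 eqxx /=.
  by apply/forall_inP => u; rewrite inE.
have /card_gt0P[v vS] : 0 < #|S| by apply: leq_trans hS; rewrite expn_gt0.
pose A := [set u in S | adj v u].
pose B := [set u in S :\ v | ~~ adj v u].
have cS : #|S| = (#|A| + #|B|).+1.
  rewrite (cardsD1 v S) vS add1n -cardsUI; congr _.+1.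
  have -> : A :&: B = set0.
    by apply/setP => u; rewrite !inE; case: (adj v u); rewrite ?andbF.
  rewrite cards0 addn0; apply: eq_card => u; rewrite !inE.
  case: eqP => [->|_]; first by rewrite adj_irrefl andbF.
  by case: (u \in S); case: (adj v u).
have vA u : u \in A -> adj v u by rewrite inE => /andP[].
have vB u : u \in B -> ~~ adj v u by rewrite inE => /andP[].
have AS : A \subset S by apply/subsetP => u; rewrite inE => /andP[].
have BS : B \subset S.
  by apply/subsetP => u; rewrite !inE => /andP[/andP[]].
have nvA : v \notin A by rewrite inE adj_irrefl andbF.
have nvB : v \notin B by rewrite !inE eqxx.
have [hA|hA] := leqP (2 ^ (a + b.+1)) #|A|.
  have [X [XA /orP[/andP[/eqP cX qX]|hX]]] := IHa _ _ hA; last first.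
    by exists X; split; [apply: subset_trans XA AS | rewrite hX orbT].
  have nvX : v \notin X by apply: contra nvA; apply: (subsetP XA).
  exists (v |: X); split.
    by rewrite subUset sub1set vS; apply: subset_trans XA AS.
  rewrite cardsU1 nvX cX add1n eqxx /=; apply/orP; left.
  apply/forall_inP => x; rewrite in_setU1 => hx.
  apply/forall_inP => y; rewrite in_setU1 => hy; apply/implyP => xy.
  case/predU1P: hx => [ex|xX]; case/predU1P: hy => [ey|yX].
  - by rewrite ex ey eqxx in xy.
  - by rewrite ex; apply/vA/(subsetP XA).
  - by rewrite ey adj_sym; apply/vA/(subsetP XA).
  - by move/forall_inP: qX => /(_ _ xX)/forall_inP/(_ _ yX)/implyP; apply.
have hB : 2 ^ (a.+1 + b) <= #|B|.
  rewrite leqNgt; apply/negP => hB; move: hS; apply/negP; rewrite -ltnNge cS.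
  rewrite addSn expnS mul2n -addnn -addSn -addnS.
  by apply: leq_add => //; rewrite -addSnnS.
have [X [XB /orP[hX|/andP[/eqP cX qX]]]] := IHb _ hB.
  by exists X; split; [apply: subset_trans XB BS | rewrite hX].
have nvX : v \notin X by apply: contra nvB; apply: (subsetP XB).
exists (v |: X); split.
  by rewrite subUset sub1set vS; apply: subset_trans XB BS.
rewrite cardsU1 nvX cX add1n eqxx /=; apply/orP; right.
apply/forall_inP => x; rewrite in_setU1 => hx.
apply/forall_inP => y; rewrite in_setU1 => hy.
case/predU1P: hx => [ex|xX]; case/predU1P: hy => [ey|yX].
- by rewrite ex ey adj_irrefl.
- by rewrite ex; apply/vB/(subsetP XB).
- by rewrite ey adj_sym; apply/vB/(subsetP XB).
- by move/forall_inP: qX => /(_ _ xX)/forall_inP/(_ _ yX).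
Qed.

End Graphs.

Definition ramsey_prop (k N : nat) : Prop :=
  forall G : sgraph, N <= #|G| ->
    exists S : {set G}, #|S| = k /\ (clique S \/ independent S).

Lemma ramsey_exists k : exists N, `[< ramsey_prop k N >].
Proof.
exists (2 ^ (k + k)); apply/asboolP => G; rewrite -cardsT => hG.
have [X [_ /orP[/andP[/eqP cX hX]|/andP[/eqP cX hX]]]] := ramsey_set hG.
  by exists X; split => //; left.
by exists X; split => //; right.
Qed.

Definition ramsey (k : nat) : nat := ex_minn (ramsey_exists k).

Definition nonfeasible_order (D k n : nat) : Prop :=
  exists G : sgraph, [/\ #|G| = n, max_degree G <= D & ~~ k_feasible k G].

Definition deletion_value (D k n : nat) : Prop :=
  exists G : sgraph, max_degree G <= D /\ fk k G = n.

Definition empty_graph : sgraph :=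
  @SGraph void (fun _ _ => false) (fun _ _ => erefl) (fun _ => erefl).

Lemma max_degree_empty D : max_degree empty_graph <= D.
Proof. by apply/bigmax_leqP => -[]. Qed.

Lemma h_exists D k : 1 < k -> exists n, `[< nonfeasible_order D k n >].
Proof.
move=> hk; exists 0; apply/asboolP; exists empty_graph; split.
- by rewrite card_void.
- exact: max_degree_empty.
apply/existsP => -[S]; rewrite leqNgt => /negP; apply.
apply: leq_ltn_trans (max_card _) _.
rewrite card_induced; apply: leq_ltn_trans (max_card _) _.
by rewrite card_void; apply: ltnW.
Qed.

Lemma h_bounded D k n : `[< nonfeasible_order D k n >] -> n <= k * D + k.
Proof. by move=> /asboolP[G [<- hD nf]]; apply: nonfeasible_ub. Qed.

(* For k = 0 every graph is k-feasible and there is no maximum, hence [hk]. *)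
Definition h (D k : nat) (hk : 1 < k) : nat :=
  ex_maxn (h_exists D hk) (@h_bounded D k).

Lemma g_exists D k : exists n, `[< deletion_value D k n >].
Proof.
exists (fk k empty_graph); apply/asboolP; exists empty_graph; split => //.
exact: max_degree_empty.
Qed.

Lemma g_bounded D k n : `[< deletion_value D k n >] -> n <= k * D.
Proof. by move=> /asboolP[G [hD <-]]; apply: fk_ub. Qed.

Definition g (D k : nat) : nat := ex_maxn (g_exists D k) (@g_bounded D k).

Arguments h : clear implicits.

(* Main.v *)
From mathcomp Require Import zify.
Require Import Defs.
From mathcomp Require Import all_boot boolp.

(** A graph is k-feasible exactly when, for some d and some vertex set S
    inducing a subgraph of maximum degree at most d, at least k vertices of S
    have degree d inside S ([k_feasibleP]).  In particular a non-k-feasible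
    graph has fewer than k vertices in every independent set, in every clique
    and in every induced matching, and fewer than k vertices of degree 2 when
    its maximum degree is 2.  The cliques and independent sets give the Ramsey
    bound.  The bound through g holds because an optimal deletion cannot leave
    k vertices of maximum degree, hence leaves fewer than k vertices.

    The upper bounds for maximum degree 1 and 2 both come from one inequality,
    valid for every graph of maximum degree at most 2 with n vertices, n2 of
    which have degree 2:
      2 n <= 2 |A| + |M| + n2
    for some independent set A and some vertex set M of even size spanned by an
    induced matching ([path_cycle_boundP]).  It holds by induction on n, with no
    classification of paths and cycles: deleting a vertex of degree 2 that has
    a neighbour of degree 2 costs 2 on the left and at least 2 in n2, and when
    there is no such vertex every component is a star with at most two leaves,
    where A collects the leaves and M is a single edge.  In a non-k-feasible
    graph |A| <= k-1, |M| <= 2 floor((k-1)/2) because |M| is even, and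
    n2 <= k-1.

    The bounds are attained by disjoint unions of paths P1, P2 and P4.  The
    largest number of vertices of degree d in an induced subgraph of maximum
    degree at most d is subadditive under disjoint union
    ([class_bound_dunion]), so it suffices to know it for each of these paths:
    P1 contributes 1 for d = 0 only, P2 contributes 1 for d = 0 and 2 for d = 1,
    and P4 contributes at most 2 for every d. *)

Set Implicit Arguments.
Unset Strict Implicit.
Unset Printing Implicit Defensive.

(** * Degrees inside a vertex set and feasibility *)

Section DegreeIn.
Variable G : sgraph.
Implicit Types (S T C A M : {set G}) (u v x y : G).

Definition deg_in S v : nat := #|[set u in S | adj v u]|.

Definition deg_class S d : {set G} := [set v in S | deg_in S v == d].

Lemma degree_deg_in v : degree v = deg_in [set: G] v.
Proof. by apply: eq_card => u; rewrite !inE. Qed.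

Lemma deg_in_le S T v : S \subset T -> deg_in S v <= deg_in T v.
Proof.
move=> /subsetP sST; apply: subset_leq_card; apply/subsetP => u.
by rewrite !inE => /andP[/sST -> ->].
Qed.

Lemma deg_in_gt0 S u v : u \in S -> adj v u -> 0 < deg_in S v.
Proof. by move=> uS vu; apply/card_gt0P; exists u; rewrite inE uS. Qed.

Lemma deg_inD1 S u v : u \in S -> adj v u -> deg_in S v = (deg_in (S :\ u) v).+1.
Proof.
move=> uS vu; rewrite /deg_in (cardsD1 u) inE uS vu add1n; congr _.+1.
by apply: eq_card => w; rewrite !inE andbA.
Qed.

Lemma deg_in1_uniq S v x y :
  deg_in S v = 1 -> x \in S -> y \in S -> adj v x -> adj v y -> x = y.
Proof.
move=> /eqP/cards1P[z hz] xS yS vx vy.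
have : x \in [set u in S | adj v u] by rewrite inE xS.
have : y \in [set u in S | adj v u] by rewrite inE yS.
by rewrite hz !inE => /eqP-> /eqP->.
Qed.

Lemma deg_class2_sub S T : S \subset T -> {in T, forall v, deg_in T v <= 2} ->
  deg_class S 2 \subset deg_class T 2.
Proof.
move=> sST hT; apply/subsetP => v; rewrite !inE => /andP[vS /eqP dv].
have vT := subsetP sST _ vS.
by rewrite vT eqn_leq hT //= -dv deg_in_le.
Qed.

(** Only an upper bound d on the degrees inside S is required: since k is
    positive some vertex attains d, so d is then the maximum degree of the
    subgraph induced by S. *)
Lemma k_feasibleP k : 0 < k ->
  reflect (exists S d, {in S, forall v, deg_in S v <= d} /\ k <= #|deg_class S d|)
          (k_feasible k G).
Proof.
move=> k0; apply: (iffP existsP) => -[S].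
  move=> hS; exists S, (max_degree (induced S)).
  have dE (v : induced S) : deg_in S (val v) = degree v by rewrite degree_induced.
  split=> [v vS|].
    by rewrite (dE (Sub v vS)); apply: leq_bigmax.
  apply: leq_trans hS _; rewrite -(card_imset _ val_inj); apply: subset_leq_card.
  apply/subsetP => _ /imsetP[v + ->]; rewrite inE => dv.
  by rewrite inE dE dv andbT; apply: valP.
move=> [d [dS hk]]; exists S; apply: leq_trans hk _.
have mdE : deg_class S d != set0 -> max_degree (induced S) = d.
  case/set0Pn=> v; rewrite inE => /andP[vS /eqP dv].
  apply/eqP; rewrite eqn_leq; apply/andP; split.
    by apply/bigmax_leqP => -[w wS] _; rewrite degree_induced; apply: dS.
  rewrite -{1}dv -[deg_in S v](@degree_induced _ S (Sub v vS)).
  exact: leq_bigmax.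
have [->|/mdE dE] := eqVneq (deg_class S d) set0; first by rewrite cards0.
rewrite -[leqRHS](card_imset _ val_inj); apply: subset_leq_card.
apply/subsetP => v; rewrite inE => /andP[vS dv].
by apply/imsetP; exists (Sub v vS) => //; rewrite inE degree_induced dE.
Qed.

Lemma regular_card_lt k S d : 0 < k -> ~~ k_feasible k G ->
  {in S, forall v, deg_in S v = d} -> #|S| < k.
Proof.
move=> k0 nf dS; rewrite ltnNge; apply: contra nf => kS.
apply/k_feasibleP => //; exists S, d; split=> [v /dS->//|].
apply: leq_trans kS (subset_leq_card _); apply/subsetP => v vS.
by rewrite inE vS dS ?eqxx.
Qed.

Lemma independent_deg_in S : independent S -> {in S, forall v, deg_in S v = 0}.
Proof.
move=> /forall_inP iS v vS; apply: eq_card0 => u; rewrite !inE.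
by apply/andP => -[uS vu]; move/forall_inP: (iS v vS) => /(_ u uS); rewrite vu.
Qed.

Lemma clique_deg_in S : clique S -> {in S, forall v, deg_in S v = #|S|.-1}.
Proof.
move=> /forall_inP cS v vS; rewrite (cardsD1 v S) vS add1n /=.
apply: eq_card => u; rewrite !inE andbC.
have [->|nuv] := eqVneq u v; first by rewrite adj_irrefl.
have [uS|] := boolP (u \in S); rewrite ?andbF // andbT.
by move/forall_inP: (cS v vS) => /(_ u uS); rewrite eq_sym nuv.
Qed.

(** * An inequality for graphs of maximum degree at most two *)

Definition induced_matching M : Prop := {in M, forall v, deg_in M v = 1}.

Definition apart S T : Prop := {in S & T, forall x y, ~~ adj x y}.

Lemma independentU S T :
  apart S T -> independent S -> independent T -> independent (S :|: T).
Proof.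
move=> aST /forall_inP iS /forall_inP iT.
apply/forall_inP => x xST; apply/forall_inP => y.
case/setUP: xST => [xS|xT] /setUP[yS|yT].
- by move/forall_inP: (iS x xS); apply.
- exact: aST.
- by rewrite adj_sym; apply: aST.
- by move/forall_inP: (iT x xT); apply.
Qed.

Lemma deg_inU S T v : {in T, forall u, ~~ adj v u} -> deg_in (S :|: T) v = deg_in S v.
Proof.
move=> vT; apply: eq_card => u; rewrite !inE.
have [uT|_] := boolP (u \in T); last by rewrite orbF.
by rewrite (negbTE (vT u uT)) !andbF.
Qed.

Lemma induced_matchingU S T : apart S T ->
  induced_matching S -> induced_matching T -> induced_matching (S :|: T).
Proof.
move=> aST mS mT x /setUP[xS|xT].
  by rewrite deg_inU ?mS // => u uT; apply: aST.
by rewrite setUC deg_inU ?mT // => u uS; rewrite adj_sym; apply: aST.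
Qed.

Lemma apart_sub S S' T T' : S' \subset S -> T' \subset T -> apart S T -> apart S' T'.
Proof. by move=> /subsetP sS /subsetP sT aST x y /sS xS /sT; apply: aST. Qed.

(** The parity of M is part of the conclusion so that fewer than k vertices in
    M means at most twice floor((k-1)/2), without a handshake argument. *)
Definition path_cycle_bound S : Prop :=
  exists A M, [/\ A \subset S, M \subset S, independent A,
    induced_matching M /\ ~~ odd #|M| &
    2 * #|S| <= 2 * #|A| + #|M| + #|deg_class S 2|].

(** When C is a union of components of the graph induced by S, the sets
    chosen in C and in the rest can be united, and the vertices of degree 2 of
    the rest have degree 2 in S as well. *)
Lemma path_cycle_bound_split S C A M : {in S, forall v, deg_in S v <= 2} ->
  C \subset S -> apart C (S :\: C) ->
  A \subset C -> M \subset C -> independent A ->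
  induced_matching M -> ~~ odd #|M| -> 2 * #|C| <= 2 * #|A| + #|M| ->
  path_cycle_bound (S :\: C) -> path_cycle_bound S.
Proof.
move=> dS CS aC AC MC iA mM eM cC [A' [M' [AS MS iA' [mM' eM'] cS]]].
have dis (X Y : {set G}) : X \subset C -> Y \subset S :\: C -> #|X :|: Y| = #|X| + #|Y|.
  move=> XC YS; rewrite cardsU (_ : X :&: Y = set0) ?cards0 ?subn0 //.
  apply/setP => x; rewrite !inE; apply/andP => -[/(subsetP XC) xC].
  by move/(subsetP YS); rewrite inE xC.
have SDS : S :\: C \subset S by apply: subsetDl.
exists (A :|: A'), (M :|: M'); split.
- by rewrite subUset (subset_trans AC CS) (subset_trans AS SDS).
- by rewrite subUset (subset_trans MC CS) (subset_trans MS SDS).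
- by apply: independentU => //; apply: apart_sub aC.
- split; first by apply: induced_matchingU => //; apply: apart_sub aC.
  by rewrite dis // oddD (negbTE eM) (negbTE eM').
- have := subset_leq_card (deg_class2_sub SDS dS).
  rewrite !dis //; have := cardsID C S; rewrite (setIidPr CS); lia.
Qed.

Lemma independent1 v : independent [set v].
Proof.
by apply/forall_inP => _ /set1P->; apply/forall_inP => _ /set1P->; rewrite adj_irrefl.
Qed.

Lemma induced_matching0 : induced_matching set0.
Proof. by move=> v; rewrite inE. Qed.

Lemma induced_matching2 u v : adj u v -> induced_matching [set u; v].
Proof.
have E x y : adj x y -> deg_in [set x; y] x = 1.
  move=> xy; apply/eqP/cards1P; exists y; apply/setP => z; rewrite !inE.
  have [->|_] := eqVneq z x; rewrite /= ?adj_irrefl.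
    by apply/esym/negbTE; apply: contraTneq xy => ->; rewrite adj_irrefl.
  by have [->|_] := eqVneq z y; rewrite ?xy.
move=> uv _ /set2P[->|->]; first exact: E.
by rewrite setUC E // adj_sym.
Qed.

(** When all neighbours of v are leaves, v and its neighbours form a star
    component; with l >= 1 leaves, the leaves and one edge give
    2 (l + 1) = 2 l + 2. *)
Lemma path_cycle_bound_star S v : {in S, forall v, deg_in S v <= 2} -> v \in S ->
  {in S, forall u, adj v u -> deg_in S u = 1} ->
  let C := v |: [set u in S | adj v u] in
  path_cycle_bound (S :\: C) -> path_cycle_bound S.
Proof.
set N := [set u in S | adj v u] => dS vS leafN C.
have NP u : u \in N -> [/\ u \in S, adj v u & adj u v].
  by rewrite inE => /andP[uS vu]; split; rewrite // adj_sym.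
have nbrN u w : u \in N -> w \in S -> adj u w -> w = v.
  move=> /NP[uS vu uv] wS uw; exact: deg_in1_uniq (leafN u uS vu) wS vS uw uv.
have NS : N \subset S by apply/subsetP => u /NP[].
have CS : C \subset S by rewrite subUset sub1set vS.
have nvN : v \notin N by rewrite inE adj_irrefl andbF.
have cC : #|C| = #|N|.+1 by rewrite cardsU1 nvN.
have aC : apart C (S :\: C).
  move=> x y xC /setDP[yS]; rewrite !inE negb_or yS /= => /andP[yv nvy].
  case/setU1P: xC => [->//|xN].
  by apply: contra yv => xy; rewrite (nbrN x y).
have [N0|/set0Pn[u uN]] := eqVneq N set0.
  apply: (@path_cycle_bound_split _ C [set v] set0) => //.
  - by rewrite sub1set setU11.
  - exact: sub0set.
  - exact: independent1.
  - exact: induced_matching0.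
  - by rewrite cards0.
  - by rewrite cC N0 cards1 cards0.
have [uS vu uv] := NP u uN.
have c2 : #|[set v; u]| = 2.
  by rewrite cards2; case: eqP => // vuE; move: vu; rewrite vuE adj_irrefl.
apply: (@path_cycle_bound_split _ C N [set v; u]) => //.
- exact: subsetUr.
- by rewrite subUset !sub1set setU11 setU1r.
- apply/forall_inP => x xN; apply/forall_inP => y yN.
  apply/negP => xy; have [yS _ _] := NP y yN.
  by rewrite (nbrN x y) ?(negbTE nvN) // in yN.
- exact: induced_matching2.
- by rewrite c2.
- by rewrite cC c2; lia.
Qed.

(** Deleting a vertex v of degree 2 with a neighbour u of degree 2 removes both
    from the vertices of degree 2, which pays for v, and A and M are kept.
    Otherwise a vertex of largest degree is the centre of a star component. *)
Lemma path_cycle_boundP S : {in S, forall v, deg_in S v <= 2} -> path_cycle_bound S.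
Proof.
move: {2}#|S|.+1 (ltnSn #|S|) => n; elim: n S => // n IH S cS dS.
have [->|/set0Pn[v0 v0S]] := eqVneq S set0.
  exists set0, set0; split; rewrite ?cards0 ?sub0set //.
  - by apply/forall_inP => v; rewrite inE.
  - by split=> //; apply: induced_matching0.
have IHS (T : {set G}) v : T \subset S -> v \in S -> v \notin T -> path_cycle_bound T.
  move=> TS vS vT; apply: IH => [|u uT].
    apply: leq_trans (cS : #|S| <= n); apply: proper_card; apply/properP; split=> //.
    by exists v.
  by apply: leq_trans (deg_in_le u TS) (dS u (subsetP TS u uT)).
have [/exists_inP[v]|noadj] :=
  boolP [exists v in deg_class S 2, [exists u in deg_class S 2, adj v u]].
  move=> v2 /exists_inP[u u2 vu].
  have /andP[vS _] : (v \in S) && (deg_in S v == 2) by move: v2; rewrite inE.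
  have /andP[uS /eqP du] : (u \in S) && (deg_in S u == 2) by move: u2; rewrite inE.
  have DS : S :\ v \subset S by apply: subsetDl.
  have [A [M [AS MS iA mM cA]]] := IHS (S :\ v) v DS vS (negbT (setD11 v S)).
  exists A, M; split; rewrite ?(subset_trans AS DS) ?(subset_trans MS DS) //.
  have sub : deg_class (S :\ v) 2 \subset deg_class S 2 :\ v :\ u.
    apply/subsetP => w w2; rewrite in_setD1 in_setD1.
    rewrite (subsetP (deg_class2_sub DS dS)) // andbT.
    move: w2; rewrite in_set in_setD1 -andbA => /and3P[-> _ dw]; rewrite andbT.
    apply: contraTneq dw => ->.
    by have := deg_inD1 vS (etrans (adj_sym u v) vu); rewrite du => -[<-].
  have := subset_leq_card sub.
  have := cardsD1 v (deg_class S 2); have := cardsD1 u (deg_class S 2 :\ v).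
  have := cardsD1 v S; rewrite vS v2 in_setD1 u2 andbT.
  have -> : u != v by apply: contraTneq vu => ->; rewrite adj_irrefl.
  lia.
(* A neighbour u of degree above 1 would be as large in degree as v, making
   u and v adjacent vertices of degree 2. *)
have [v vS maxv] := arg_maxnP (deg_in S) v0S.
apply: (path_cycle_bound_star dS vS) => [u uS vu|].
  have u_gt0 : 0 < deg_in S u by apply: deg_in_gt0 vS _; rewrite adj_sym.
  apply/eqP; rewrite eqn_leq u_gt0 andbT leqNgt; apply/negP => u_gt1.
  move/exists_inP: noadj; case; exists v.
    have vS' : v \in S := vS.
    by rewrite inE vS' eqn_leq dS //; apply: leq_trans u_gt1 (maxv u uS).
  by apply/exists_inP; exists u => //; rewrite inE uS eqn_leq dS.
by apply: (IHS _ v); rewrite ?subsetDl // !inE eqxx.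
Qed.

Lemma nonfeasible_path_cycle k : 0 < k -> ~~ k_feasible k G -> max_degree G <= 2 ->
  #|G| <= k - 1 + (k - 1)./2 + #|deg_class [set: G] 2|./2.
Proof.
move=> k0 nf dG.
have dT : {in [set: G], forall v, deg_in [set: G] v <= 2}.
  by move=> v _; rewrite -degree_deg_in; apply: leq_trans dG; apply: leq_bigmax.
have [A [M [_ _ iA [mM eM] c]]] := path_cycle_boundP dT.
have := regular_card_lt k0 nf (independent_deg_in iA).
have := regular_card_lt k0 nf mM.
rewrite cardsT in c; lia.
Qed.

End DegreeIn.

(** * Disjoint unions of paths *)

Section DisjointUnion.
Variables G H : sgraph.

Definition dunion_adj : rel (G + H) := fun u v =>
  match u, v with
  | inl x, inl y => adj x y
  | inr x, inr y => adj x y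
  | _, _ => false
  end.

Lemma dunion_adj_sym : symmetric dunion_adj.
Proof. by move=> [x|x] [y|y] //=; apply: adj_sym. Qed.

Lemma dunion_adj_irrefl : irreflexive dunion_adj.
Proof. by move=> [x|x] /=; apply: adj_irrefl. Qed.

Definition dunion : sgraph := SGraph dunion_adj_sym dunion_adj_irrefl.

Lemma card_dunion_set (S : {set dunion}) :
  #|S| = #|[set x | inl x \in S]| + #|[set x | inr x \in S]|.
Proof.
by rewrite -!sum1_card big_sumType; congr (_ + _); apply: eq_bigl => x; rewrite !inE.
Qed.

Lemma deg_in_dunion_l (S : {set dunion}) (x : G) :
  deg_in S (inl x : dunion) = deg_in [set x | inl x \in S] x.
Proof.
rewrite /deg_in card_dunion_set -[RHS]addn0; congr (_ + _).
  by apply: eq_card => y; rewrite !inE.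
by apply: eq_card0 => y; rewrite !inE andbF.
Qed.

Lemma deg_in_dunion_r (S : {set dunion}) (x : H) :
  deg_in S (inr x : dunion) = deg_in [set x | inr x \in S] x.
Proof.
rewrite /deg_in card_dunion_set -[RHS]add0n; congr (_ + _).
  by apply: eq_card0 => y; rewrite !inE andbF.
by apply: eq_card => y; rewrite !inE.
Qed.

End DisjointUnion.

(** c d bounds the number of vertices of degree d in induced subgraphs of
    maximum degree at most d; by [k_feasibleP], if c stays below k then G is not
    k-feasible. *)
Definition class_bound (G : sgraph) (c : nat -> nat) : Prop :=
  forall (S : {set G}) d, {in S, forall v, deg_in S v <= d} -> #|deg_class S d| <= c d.

Lemma max_degree_dunion (G H : sgraph) D :
  max_degree G <= D -> max_degree H <= D -> max_degree (dunion G H) <= D.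
Proof.
move=> dG dH; apply/bigmax_leqP => -[x|x] _; rewrite degree_deg_in.
  rewrite deg_in_dunion_l; apply: leq_trans dG; apply: leq_trans (leq_bigmax x).
  by rewrite degree_deg_in deg_in_le ?subsetT.
rewrite deg_in_dunion_r; apply: leq_trans dH; apply: leq_trans (leq_bigmax x).
by rewrite degree_deg_in deg_in_le ?subsetT.
Qed.

(** A set S of the union splits into its traces on G and on H, and degrees
    inside S are degrees inside the traces. *)
Lemma class_bound_dunion (G H : sgraph) c c' : class_bound G c -> class_bound H c' ->
  class_bound (dunion G H) (fun d => c d + c' d).
Proof.
move=> bG bH S d dS; rewrite card_dunion_set; apply: leq_add.
  apply: leq_trans (bG [set x | inl x \in S] d _).
    by apply: subset_leq_card; apply/subsetP => x; rewrite !inE deg_in_dunion_l.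
  by move=> x; rewrite inE => /dS; rewrite deg_in_dunion_l.
apply: leq_trans (bH [set x | inr x \in S] d _).
  by apply: subset_leq_card; apply/subsetP => x; rewrite !inE deg_in_dunion_r.
by move=> x; rewrite inE => /dS; rewrite deg_in_dunion_r.
Qed.

Definition copies n (G : sgraph) : sgraph := iter n (dunion G) empty_graph.

Lemma card_copies n (G : sgraph) : #|copies n G| = n * #|G|.
Proof.
elim: n => [|n IH]; first by rewrite card_void.
by rewrite mulSn -IH; exact: card_sum.
Qed.

Lemma max_degree_copies n (G : sgraph) D : max_degree G <= D -> max_degree (copies n G) <= D.
Proof.
move=> dG; elim: n => [|n IH]; first exact: max_degree_empty.
exact: max_degree_dunion.
Qed.

Lemma class_bound_copies n (G : sgraph) c :
  class_bound G c -> class_bound (copies n G) (fun d => n * c d).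
Proof.
move=> bG; elim: n => [|n IH] S d dS.
  by apply: leq_trans (max_card _) _; rewrite card_void.
by rewrite mulSn; apply: (class_bound_dunion bG IH).
Qed.

Lemma class_bound_nonfeasible k (G : sgraph) c : 0 < k ->
  class_bound G c -> (forall d, c d < k) -> ~~ k_feasible k G.
Proof.
move=> k0 bG ck; apply/k_feasibleP => // -[S [d [dS kS]]].
by have := leq_trans kS (bG S d dS); rewrite leqNgt ck.
Qed.

Definition path_adj n : rel 'I_n := fun i j => (i.+1 == j) || (j.+1 == i).

Lemma path_adj_sym n : symmetric (@path_adj n).
Proof. by move=> i j; apply: orbC. Qed.

Lemma path_adj_irrefl n : irreflexive (@path_adj n).
Proof. by move=> i; rewrite /path_adj orbb eqn_leq ltnn. Qed.

Definition path_graph n : sgraph := SGraph (@path_adj_sym n) (@path_adj_irrefl n).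

Lemma card_pred_sum n (P : pred 'I_n) : #|[set i | P i]| = \sum_(i < n) P i.
Proof.
by rewrite -sum1_card big_mkcond; apply: eq_bigr => i _; rewrite inE; case: (P i).
Qed.

Lemma deg_in_path n (S : {set path_graph n}) (i : 'I_n) :
  deg_in S (i : path_graph n) = \sum_(j < n) ((j \in S) && path_adj i j).
Proof. exact: card_pred_sum. Qed.

Lemma deg_class_path n (S : {set path_graph n}) d :
  #|deg_class S d| =
    \sum_(i < n) ((i \in S) && (\sum_(j < n) ((j \in S) && path_adj i j) == d)).
Proof.
by rewrite [LHS]card_pred_sum; apply: eq_bigr => i _; rewrite -deg_in_path.
Qed.

Lemma max_degree_lt_card (G : sgraph) : max_degree G <= #|G|.-1.
Proof.
apply/bigmax_leqP => v _; rewrite -(cardsC1 v).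
apply: subset_leq_card; apply/subsetP => u; rewrite !inE => vu.
by apply: contraTneq vu => ->; rewrite adj_irrefl.
Qed.

Lemma max_degree_path4 : max_degree (path_graph 4) <= 2.
Proof.
apply/bigmax_leqP => -[i lti] _; rewrite degree_deg_in deg_in_path.
rewrite !(big_ord_recl, big_ord0) !in_setT /path_adj /=.
by case: i lti => [|[|[|[|]]]].
Qed.

Lemma class_bound_path1 : class_bound (path_graph 1) (fun d => d == 0).
Proof.
move=> S d _; rewrite deg_class_path !(big_ord_recl, big_ord0) /= /path_adj /=.
by rewrite andbF eq_sym; case: (_ \in S); case: d.
Qed.

Lemma class_bound_path2 : class_bound (path_graph 2) (fun d => (d == 0) + 2 * (d == 1)).
Proof.
move=> S d dS.
have dS' i : i \in S -> \sum_(j < 2) ((j \in S) && path_adj i j) <= d.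
  by move=> /dS; rewrite deg_in_path.
rewrite deg_class_path.
move: (dS' ord0) (dS' (lift ord0 ord0)).
rewrite !(big_ord_recl, big_ord0) /= /path_adj /=.
by case: (ord0 \in S); case: (_ \in S); case: d {dS dS'} => [|[|d]] //= h1 h2;
  move: (h1 isT) (h2 isT).
Qed.

(** For d = 0 each half of the path has at most one vertex; for d = 1, an end
    of the path and its neighbour in S exclude the third vertex and isolate the
    fourth; for d = 2 only the two inner vertices qualify.  All of this is
    checked on the sixteen possible sets S. *)
Lemma class_bound_path4 : class_bound (path_graph 4) (fun=> 2).
Proof.
move=> S d dS.
have dS' i : i \in S -> \sum_(j < 4) ((j \in S) && path_adj i j) <= d.
  by move=> /dS; rewrite deg_in_path.
rewrite deg_class_path.
move: (dS' ord0) (dS' (lift ord0 ord0)) (dS' (lift ord0 (lift ord0 ord0)))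
  (dS' (lift ord0 (lift ord0 (lift ord0 ord0)))).
rewrite !(big_ord_recl, big_ord0) /= /path_adj /=.
do 4![case: (_ \in S)]; case: d {dS dS'} => [|[|[|d]]] //= h1 h2 h3 h4;
  by move: (h1 isT) || move: (h2 isT) || move: (h3 isT).
Qed.

(** * The values of h *)

Lemma h_eq D k (hk : 1 < k) n : nonfeasible_order D k n ->
  (forall G : sgraph, max_degree G <= D -> ~~ k_feasible k G -> #|G| <= n) ->
  h D k hk = n.
Proof.
move=> exn ubn; rewrite /h; case: ex_maxnP => m /asboolP[G [<- dG nf]] maxm.
by apply/eqP; rewrite eqn_leq ubn //=; apply/maxm/asboolP.
Qed.

Lemma h_attained D k (hk : 1 < k) : nonfeasible_order D k (h D k hk).
Proof. by rewrite /h; case: ex_maxnP => m /asboolP. Qed.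

(** A clique or an independent set of size k induces a regular graph on k
    vertices. *)
Lemma nonfeasible_lt_ramsey k (G : sgraph) : 0 < k -> ~~ k_feasible k G -> #|G| < ramsey k.
Proof.
move=> k0 nf; rewrite /ramsey; case: ex_minnP => N /asboolP RN _.
rewrite ltnNge; apply/negP => /RN[S [cS hS]].
suff [d dS] : exists d, {in S, forall v, deg_in S v = d}.
  by have := regular_card_lt k0 nf dS; rewrite cS ltnn.
case: hS => [/clique_deg_in|/independent_deg_in] dS; first by exists #|S|.-1.
by exists 0.
Qed.

(** An optimal deletion set has at most g D k vertices, and in a
    non-k-feasible graph what it leaves has fewer than k vertices. *)
Lemma nonfeasible_le_deletion D k (G : sgraph) :
  max_degree G <= D -> ~~ k_feasible k G -> #|G| <= g D k + k - 1.
Proof.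
move=> dG nf; have fg : fk k G <= g D k.
  by rewrite /g; case: ex_maxnP => m _; apply; apply/asboolP; exists G.
move: fg; rewrite /fk; case: arg_minnP => [|X gX _]; first exact: good_deletionT.
have {gX} : #|~: X| < k.
  move: gX; rewrite /good_deletion card_induced => /orP[kX|//].
  by case/existsP: nf; exists (~: X).
by have := cardsC X; lia.
Qed.

Lemma deg_class2_eq0 (G : sgraph) : max_degree G <= 1 -> deg_class [set: G] 2 = set0.
Proof.
move=> dG; apply/setP => v; rewrite !inE -degree_deg_in; apply/negbTE.
by rewrite neq_ltn (leq_ltn_trans (leq_bigmax v) (leq_ltn_trans dG _)).
Qed.

Lemma h_max_degree0 k (hk : 1 < k) : h 0 k hk = k - 1.
Proof.
have k0 := ltnW hk; apply: h_eq => [|G dG nf].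
  exists (copies (k - 1) (path_graph 1)); split.
  - by rewrite card_copies card_ord muln1.
  - by apply/max_degree_copies/(leq_trans (max_degree_lt_card _)); rewrite card_ord.
  - apply: (class_bound_nonfeasible k0 (class_bound_copies class_bound_path1)).
    by case=> [|d] /=; lia.
suff: #|[set: G]| < k by rewrite cardsT; lia.
apply: (@regular_card_lt _ _ _ 0) => // v _.
apply/eqP; rewrite -leqn0 -degree_deg_in; apply: leq_trans dG; exact: leq_bigmax.
Qed.

(** Extremal graph: floor((k-1)/2) disjoint edges and floor(k/2) isolated vertices. *)
Lemma h_max_degree1 k (hk : 1 < k) : h 1 k hk = k./2 + 2 * (k - 1)./2.
Proof.
have k0 := ltnW hk; apply: h_eq => [|G dG nf].
  exists (dunion (copies k./2 (path_graph 1)) (copies (k - 1)./2 (path_graph 2))); split.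
  - by rewrite card_sum !card_copies !card_ord; lia.
  - by apply: max_degree_dunion; apply: max_degree_copies;
      apply: leq_trans (max_degree_lt_card _) _; rewrite card_ord.
  - apply: (class_bound_nonfeasible k0 (class_bound_dunion
      (class_bound_copies class_bound_path1) (class_bound_copies class_bound_path2))).
    by case=> [|[|d]] /=; lia.
have := nonfeasible_path_cycle k0 nf (leqW dG).
by rewrite deg_class2_eq0 // cards0; lia.
Qed.

(** Extremal graph: floor((k-1)/2) copies of P4, with one isolated vertex
    added when k is even; that is why the value drops by one, through the
    coercion of [~~ odd k] to 0 or 1. *)
Lemma h_max_degree2 k (hk : 1 < k) : h 2 k hk = 2 * k - 2 - ~~ odd k.
Proof.
have k0 := ltnW hk; apply: h_eq => [|G dG nf].
  exists (dunion (copies (~~ odd k) (path_graph 1)) (copies (k - 1)./2 (path_graph 4))).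
  split.
  - by rewrite card_sum !card_copies !card_ord; lia.
  - apply: max_degree_dunion; apply: max_degree_copies; last exact: max_degree_path4.
    by apply: leq_trans (max_degree_lt_card _) _; rewrite card_ord.
  - apply: (class_bound_nonfeasible k0 (class_bound_dunion
      (class_bound_copies class_bound_path1) (class_bound_copies class_bound_path4))).
    by case=> [|d] /=; lia.
have n2 : #|deg_class [set: G] 2| < k.
  rewrite ltnNge; apply: contra nf => kn; apply/k_feasibleP => //.
  exists setT, 2; split=> // v _; rewrite -degree_deg_in.
  by apply: leq_trans dG; apply: leq_bigmax.
by have := nonfeasible_path_cycle k0 nf dG; lia.
Qed.

Theorem theorem4p5 (D k : nat) (hk : 1 < k) :
  (h D k hk <= ramsey k - 1) /\
  (h 0 k hk = k - 1) /\
  (h 1 k hk = k./2 + 2 * (k - 1)./2) /\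
  ((odd k -> h 2 k hk = 2 * k - 2) /\
   (~~ odd k -> h 2 k hk = 2 * k - 3)) /\
  (h D k hk <= g D k + k - 1).
Proof.
have [G [<- dG nf]] := h_attained D hk.
split; first by have := nonfeasible_lt_ramsey (ltnW hk) nf; lia.
split; first exact: h_max_degree0.
split; first exact: h_max_degree1.
split; last exact: nonfeasible_le_deletion.
by rewrite h_max_degree2; split; lia.
Qed.
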